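(* Let $A=\Delta_h^2\in\mathbb{R}^{N_x\times N_x}$, where $\Delta_h$ is the one-dimensional discrete Neumann Laplacian, and let $A=PDP^{-1}$ with $D$ diagonal. Let $T>0$, $N_t=T/\Delta t\in\mathbb{N}$, and let $\theta=1$ or $\theta=1/2$. Let $\mathbf{u}_n$, $n=0,\dots,N_t$, be given by $$\frac{\mathbf{u}_n-\mathbf{u}_{n-1}}{\Delta t}+A\big(\theta\mathbf{u}_n+(1-\theta)\mathbf{u}_{n-1}\big)=0,\quad n=1,\dots,N_t,$$ with given initial vector $\mathbf{u}_0$, and let $\mathbf{u}^k_n$, $k\ge1$, be the iterates (from an initial guess $(\mathbf{u}^0_n)_n$) of the PinT algorithm $$\frac{\mathbf{u}_n^k-\mathbf{u}_{n-1}^k}{\Delta t}+A\big(\theta\mathbf{u}_n^k+(1-\theta)\mathbf{u}_{n-1}^k\big)=0,\quad n=1,\dots,N_t,\qquad \mathbf{u}_0^k=\alpha\mathbf{u}_{N_t}^k-\alpha\mathbf{u}_{N_t}^{k-1}+\mathbf{u}_0,$$ with $|\alpha|<1/2$. Then the discrete error $\mathbf{e}_n^k=\mathbf{u}_n^k-\mathbf{u}_n$ satisfies the linear convergence estimate $$\max_{n=1,2,\dots,N_t}\| P^{-1}\mathbf{e}_n^k \|\leq \left(\frac{|\alpha|}{1-|\alpha|} \right) ^k \| P^{-1}\mathbf{e}_0^0 \|.$$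
   Context: $\Delta_h\in\mathbb{R}^{N_x\times N_x}$ is the central finite difference Laplacian on an interval with $N_x$ equidistant grid points, mesh size $h$, and homogeneous Neumann conditions: $\Delta_h=h^{-2}B$, where $B$ is tridiagonal with all diagonal entries $-2$, all sub- and superdiagonal entries $1$, except that $B_{1,2}=2$ and $B_{N_x,N_x-1}=2$. The eigenvalues of $\Delta_h$ are $\lambda_p=\frac{2}{h^2}\{\cos(\frac{(p-1)\pi}{N_x-1})-1\}$, $p=1,\dots,N_x$; $D=\mathrm{diag}(\lambda_1^2,\dots,\lambda_{N_x}^2)$ and the columns of $P$ are corresponding eigenvectors of $A$. $\|\cdot\|$ is the maximum norm on $\mathbb{R}^{N_x}$.
   Formalization: The formal theorem adds the hypothesis that the initial guess satisfies ‖P⁻¹e⁰_{N_t}‖ ≤ ‖P⁻¹e⁰_0‖ (true if the guess solves the scheme); for an arbitrary guess the estimate is false, e.g. when e⁰_0 = 0 but e⁰_{N_t} is a nonzero constant vector and α = 1/4. *)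

(* Defs.v *)
From HB Require Import structures.
From mathcomp Require Import all_boot all_order all_algebra.
From mathcomp Require Import boolp classical_sets reals topology normedtype trigo.

Set Implicit Arguments.
Unset Strict Implicit.
Unset Printing Implicit Defensive.

Import Order.TTheory GRing.Theory Num.Theory.
Import numFieldNormedType.Exports.

Local Open Scope ring_scope.

(* Indices are 0-based.  The doubled entries B_{1,2} and B_{Nx,Nx-1} come from
   eliminating the ghost points in the homogeneous Neumann conditions; for
   Nx = 2 both off-diagonal entries are doubled. *)
Definition neumann_stencil (R : realType) (Nx : nat) : 'M[R]_Nx :=
  \matrix_(i < Nx, j < Nx)
    if i == j then - 2
    else if j == i.+1 :> nat then (if i == 0%N :> nat then 2 else 1)
    else if i == j.+1 :> nat then (if i == Nx.-1 :> nat then 2 else 1)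
    else 0.

Definition neumann_laplacian (R : realType) (Nx : nat) (h : R) : 'M[R]_Nx :=
  (h ^+ 2)^-1 *: neumann_stencil R Nx.

Definition laplacian_eigenvalue (R : realType) (Nx : nat) (h : R) (p : 'I_Nx) : R :=
  2 / h ^+ 2 * (cos (p%:R * pi / (Nx.-1)%:R) - 1).

Definition squared_eigenvalues (R : realType) (Nx : nat) (h : R) : 'M[R]_Nx :=
  diag_mx (\row_(p < Nx) laplacian_eigenvalue h p ^+ 2).

Definition theta_scheme (R : realType) (Nx : nat) (A : 'M[R]_Nx) (theta dt : R)
    (Nt : nat) (w : nat -> 'cV[R]_Nx) : Prop :=
  forall n : nat, (1 <= n <= Nt)%N ->
    dt^-1 *: (w n - w n.-1) + A *m (theta *: w n + (1 - theta) *: w n.-1) = 0.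

(* [v k n] is the k-th iterate at time step n.  The initial guess [v 0] is
   unconstrained here: only [v 0 Nt] enters the iteration, so in general
   [v 0 0] is unrelated to the later iterates.  A bound on them in terms of the
   error of [v 0 0] therefore needs a link between the errors of [v 0 Nt] and
   [v 0 0]. *)
Definition pint_iterates (R : realType) (Nx : nat) (A : 'M[R]_Nx)
    (theta dt alpha : R) (Nt : nat) (u0 : 'cV[R]_Nx)
    (v : nat -> nat -> 'cV[R]_Nx) : Prop :=
  forall k : nat, (1 <= k)%N ->
    theta_scheme A theta dt Nt (v k) /\
    v k 0%N = alpha *: v k Nt - alpha *: v k.-1 Nt + u0.

(* Main.v *)
Require Import Defs.
From HB Require Import structures.
From mathcomp Require Import all_boot all_order all_algebra.
From mathcomp Require Import boolp classical_sets reals topology normedtype trigo.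
From mathcomp Require Import ring lra.

Import Order.TTheory GRing.Theory Num.Theory.
Import numFieldNormedType.Exports.

Local Open Scope ring_scope.

(** The errors are differences of two solutions of the same linear scheme, so
    they solve it too, and left multiplication by [P^-1] decouples it into the
    scalar schemes of the test equations [y' + mu y = 0], where [mu] runs
    through the squares of the eigenvalues of the discrete Laplacian.  These
    are nonnegative, and the theta scheme with [theta >= 1/2] is A-stable: a
    step never increases the absolute value ([theta_step_contractive]), hence
    the maximum norm of the transformed error [z k n] does not increase with
    [n] ([theta_scheme_diag_norm_le]).

    Subtracting [u 0 = u0] from the head-tail condition gives
    [z k 0 = alpha (z k Nt - z (k-1) Nt)].  By stability, the norm of [z k Nt] is
    at most that of [z k 0], so it can be absorbed into the left-hand side:
    [(1 - |alpha|) |z k 0| <= |alpha| |z (k-1) Nt|] ([head_tail_bound]).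
    Using stability once more, every [z k n] gains the factor
    [|alpha| / (1 - |alpha|)] over [z (k-1) Nt], and the estimate follows by
    induction on [k]; the hypothesis on the initial guess is the case [k = 0]
    of the induction. *)

Lemma mx_norm_coord_le {K : realType} {m n : nat} (x : 'M[K]_(m, n)) i j :
  `|x i j| <= `|x|.
Proof.
rewrite [leRHS]/Num.norm /= mx_normrE.
exact: (le_bigmax _ (fun ij : 'I_m * 'I_n => `|x ij.1 ij.2|) (i, j)).
Qed.

Lemma mx_norm_le {K : realType} {m n : nat} {x : 'M[K]_(m, n)} {b : K} :
  0 <= b -> (forall i j, `|x i j| <= b) -> `|x| <= b.
Proof.
move=> b_ge0 x_le; rewrite [leLHS]/Num.norm /= mx_normrE.
by apply: bigmax_le => // -[i j] _; exact: x_le.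
Qed.

(** A-stability, as an energy estimate: with [m = theta y + (1 - theta) x],
    the step says [x - y = dt mu m], while [x + y = 2 m + (2 theta - 1) (x - y)]
    identically, so [x^2 - y^2 = 2 dt mu m^2 + (2 theta - 1) (x - y)^2]. *)
Lemma theta_step_contractive {K : realFieldType} {theta dt mu x y : K} :
  1 / 2 <= theta -> 0 < dt -> 0 <= mu ->
  dt^-1 * (y - x) + mu * (theta * y + (1 - theta) * x) = 0 -> `|y| <= `|x|.
Proof.
move=> theta_ge dt_gt0 mu_ge0 step.
set m := theta * y + _ in step.
have xBy : x - y = dt * mu * m.
  apply/eqP; rewrite -subr_eq0 -oppr_eq0; apply/eqP.
  have -> : - (x - y - dt * mu * m) = dt * (dt^-1 * (y - x) + mu * m).
    by field; rewrite gt_eqF.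
  by rewrite step mulr0.
have energy : x ^+ 2 - y ^+ 2 = (dt * mu * m ^+ 2) *+ 2
                              + (2 * theta - 1) * (x - y) ^+ 2.
  have -> : (dt * mu * m ^+ 2) *+ 2 = (dt * mu * m) * m *+ 2 by ring.
  by rewrite -xBy /m; ring.
rewrite -ler_sqr ?nnegrE // !real_normK ?num_real // -subr_ge0 energy.
have theta2_ge0 : 0 <= 2 * theta - 1 by lra.
apply: addr_ge0; last by rewrite mulr_ge0 ?sqr_ge0.
by rewrite mulrn_wge0 // mulr_ge0 ?sqr_ge0 // mulr_ge0 // ltW.
Qed.

Lemma theta_scheme_sub {R : realType} {N : nat} {A : 'M[R]_N} {theta dt : R}
    {Nt : nat} {w1 w2 : nat -> 'cV[R]_N} :
  theta_scheme A theta dt Nt w1 -> theta_scheme A theta dt Nt w2 ->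
  theta_scheme A theta dt Nt (fun n => w1 n - w2 n).
Proof.
move=> s1 s2 n n_range; have := s1 n n_range; have := s2 n n_range.
set l2 := (X in X = 0 -> _) => l2_0; set l1 := (X in X = 0 -> _) => l1_0.
rewrite [RHS](_ : 0 = l1 - l2); last by rewrite l1_0 l2_0 subrr.
rewrite /l1 /l2 [in RHS]opprD [RHS]addrACA -mulmxBr -scalerBr.
have -> : w1 n - w2 n - (w1 n.-1 - w2 n.-1) = w1 n - w1 n.-1 - (w2 n - w2 n.-1).
  by rewrite !opprD addrACA.
by congr (_ + mulmx _ _); rewrite !scalerBr opprD addrACA.
Qed.

Lemma theta_scheme_conj {R : realType} {N : nat} {A P D : 'M[R]_N}
    {theta dt : R} {Nt : nat} {w : nat -> 'cV[R]_N} :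
  P \in unitmx -> A = P *m D *m invmx P ->
  theta_scheme A theta dt Nt w ->
  theta_scheme D theta dt Nt (fun n => invmx P *m w n).
Proof.
move=> P_unit -> sw n /sw /(congr1 (mulmx (invmx P))).
rewrite mulmx0 mulmxDr -scalemxAr mulmxBr !mulmxA mulVmx // mul1mx -mulmxA.
by rewrite mulmxDr -!scalemxAr.
Qed.

Lemma theta_scheme_diag_norm_le {R : realType} {N : nat} {d : 'rV[R]_N}
    {theta dt : R} {Nt : nat} {z : nat -> 'cV[R]_N} :
  1 / 2 <= theta -> 0 < dt -> (forall i, 0 <= d 0 i) ->
  theta_scheme (diag_mx d) theta dt Nt z ->
  forall n, (n <= Nt)%N -> `|z n| <= `|z 0%N|.
Proof.
move=> theta_ge dt_gt0 d_ge0 sz; elim=> [//|n IHn] n_lt.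
apply: le_trans _ (IHn (ltnW n_lt)); apply: mx_norm_le => // i j.
apply: le_trans _ (mx_norm_coord_le (z n) i j).
apply: (theta_step_contractive theta_ge dt_gt0 (d_ge0 i)).
by have /matrixP/(_ i j) := sz n.+1 n_lt; rewrite mul_diag_mx !mxE.
Qed.

(** The share of the final value [xN] in [x0] is at most [|alpha| |x0|], so it
    is absorbed on the left. *)
Lemma head_tail_bound {K : realFieldType} {V : normedModType K} {alpha : K}
    {x0 xN y : V} :
  `|alpha| < 1 -> `|xN| <= `|x0| -> x0 = alpha *: xN - alpha *: y ->
  `|x0| <= `|alpha| / (1 - `|alpha|) * `|y|.
Proof.
move=> alpha_lt1 xN_le def_x0.
have : `|x0| <= `|alpha| * `|x0| + `|alpha| * `|y|.
  rewrite {1}def_x0; apply: le_trans (ler_normB _ _) _.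
  by rewrite !normrZ lerD2r ler_wpM2l.
rewrite mulrAC ler_pdivlMr ?subr_gt0 // mulrBr mulr1 lerBlDl.
by rewrite [_ * `|alpha|]mulrC.
Qed.

Theorem theorem2p4 (R : realType) (Nx : nat) (hNx : (2 <= Nx)%N)
  (h : R) (h_gt0 : 0 < h)
  (A P D : 'M[R]_Nx)
  (defA : A = neumann_laplacian Nx h *m neumann_laplacian Nx h)
  (defD : D = squared_eigenvalues Nx h)
  (P_unit : P \in unitmx) (A_diag : A = P *m D *m invmx P)
  (T dt : R) (T_gt0 : 0 < T) (dt_gt0 : 0 < dt)
  (Nt : nat) (defNt : Nt%:R = T / dt)
  (theta : R) (htheta : theta = 1 \/ theta = 1 / 2)
  (u0 : 'cV[R]_Nx) (u : nat -> 'cV[R]_Nx)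
  (u_init : u 0%N = u0) (u_scheme : theta_scheme A theta dt Nt u)
  (alpha : R) (halpha : `|alpha| < 1 / 2)
  (v : nat -> nat -> 'cV[R]_Nx)
  (v_pint : pint_iterates A theta dt alpha Nt u0 v)
  (e : nat -> nat -> 'cV[R]_Nx) (defe : forall k n, e k n = v k n - u n)
  (guess : `|invmx P *m e 0%N Nt| <= `|invmx P *m e 0%N 0%N|) :
  forall k : nat, (1 <= k)%N ->
    \big[Num.max/0]_(1 <= n < Nt.+1) `|invmx P *m e k n|
      <= (`|alpha| / (1 - `|alpha|)) ^+ k * `|invmx P *m e 0%N 0%N|.
Proof.
have theta_ge : 1 / 2 <= theta by case: htheta => ->; lra.
have alpha_lt1 : `|alpha| < 1 by lra.
have rate_ge0 : 0 <= `|alpha| / (1 - `|alpha|).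
  by rewrite divr_ge0 // subr_ge0 ltW.
have stable k n : (1 <= k)%N -> (n <= Nt)%N ->
    `|invmx P *m e k n| <= `|invmx P *m e k 0%N|.
  move=> k_gt0 n_le; have [v_scheme _] := v_pint k k_gt0.
  have := theta_scheme_conj P_unit A_diag (theta_scheme_sub v_scheme u_scheme).
  rewrite !defe defD => z_scheme.
  apply: (theta_scheme_diag_norm_le theta_ge dt_gt0 _ z_scheme) => // i.
  by rewrite mxE sqr_ge0.
have head k : (1 <= k)%N ->
    invmx P *m e k 0%N =
    alpha *: (invmx P *m e k Nt) - alpha *: (invmx P *m e k.-1 Nt).
  move=> k_gt0; have [_ v0] := v_pint k k_gt0.
  rewrite !scalemxAr -mulmxBr !defe v0 u_init -scalerBr addrK -scalerBr.
  by congr (_ *m (_ *: _)); rewrite opprB addrA addrNK.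
have gain k n : (n <= Nt)%N -> `|invmx P *m e k.+1 n|
    <= `|alpha| / (1 - `|alpha|) * `|invmx P *m e k Nt|.
  move=> n_le; apply: le_trans (stable k.+1 n isT n_le) _.
  exact: head_tail_bound alpha_lt1 (stable k.+1 Nt isT (leqnn _)) (head k.+1 isT).
(* The induction runs on the final values only: the iterate number 0 is an
   arbitrary guess, not a solution of the scheme, so at [k = 0] the other time
   steps are not controlled. *)
have tail k : `|invmx P *m e k Nt|
    <= (`|alpha| / (1 - `|alpha|)) ^+ k * `|invmx P *m e 0%N 0%N|.
  elim: k => [|k IHk]; first by rewrite expr0 mul1r.
  by apply: le_trans (gain k Nt _) _ => //; rewrite exprS -[leRHS]mulrA ler_wpM2l.
case=> // k _; rewrite big_nat; apply: bigmax_le => [|n /andP[_ n_le]].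
  by rewrite mulr_ge0 ?exprn_ge0.
by apply: le_trans (gain k n _) _ => //; rewrite exprS -[leRHS]mulrA ler_wpM2l.
Qed.
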